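(* Consider the autonomous system $$\frac{dw_i}{dz}=f_i(w_1,\dots,w_n),\qquad 1\le i\le n,$$ where $f_1,\dots,f_n$ are rational functions of $w_1,\dots,w_n$ and the system is quasi-homogeneous, i.e. there exist positive integers $s_1,\dots,s_n$ such that, for every nonzero constant $\alpha$, $$f_i(\alpha^{s_1}w_1,\dots,\alpha^{s_n}w_n)=\alpha^{s_i+1}f_i(w_1,\dots,w_n),\qquad 1\le i\le n.$$ Suppose that $$w_i=\frac{1}{z^{s_i}}\sum_{k=0}^{\infty}c_i^{(k)}z^k,\qquad 1\le i\le n,$$ where $c^{(0)}\neq 0$, is the formal Laurent series solution of this quasi-homogeneous system obtained by the method of indeterminate coefficients. Write $c^{(k)}=(c_1^{(k)},\dots,c_n^{(k)})^\top$. Then: (i) The coefficients $c_i^{(0)}$ satisfy the nonlinear equations $$s_ic_i^{(0)}+f_i(c_1^{(0)},\dots,c_n^{(0)})=0,\qquad 1\le i\le n.$$ (ii) The coefficients $c_i^{(1)},c_i^{(2)},\dots$ each satisfy a system of linear equations of the form $$(\mathcal{L}-k\mathcal{I})\,c^{(k)}=\text{polynomial in } c_i^{(0)},\dots,c_i^{(k-1)},\qquad 1\le i\le n,\quad k\ge 1,$$ where $$\mathcal{L}\equiv\left(\frac{\partial f_i}{\partial w_j}(c_1^{(0)},\dots,c_n^{(0)})+\delta_{ij}s_i\right)_{1\le i,j\le n}$$ is the Jacobian matrix of the equations in (i). (iii) Moreover, the Laurent series above is convergent.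
   Context: The variables $z,w_1,\dots,w_n$ are complex. $\mathcal{I}$ is the $n\times n$ identity matrix and $\delta_{ij}$ is the Kronecker delta. To simplify notation, the initial data of the Cauchy problem are normalised to $z_0=w_0=0$ (stated to involve no loss of generality), so the series are expanded about $z=0$. The method of indeterminate coefficients means that the series with unknown coefficients $c_i^{(k)}$ are substituted into the system and the coefficients of equal powers of $z$ on both sides are identified; the solution so obtained is formal, no convergence being known beforehand.
   Formalization: In (ii) the right-hand side is a polynomial in c^(0),…,c^(k-1) divided by a power of the denominator of f_i at c^(0) (a bare polynomial is false for rational f_i); the f_i are explicitly assumed to be defined at c^(0). *)

(* Defs.v *)
From HB Require Import structures.
From mathcomp Require Import all_boot all_order all_algebra.
From mathcomp Require Import complex.
From mathcomp Require Import boolp reals.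
(* The notations of mpoly clash with those of the analysis library. *)
From mathcomp Require Import -(notations) mpoly.

Set Implicit Arguments.
Unset Strict Implicit.
Unset Printing Implicit Defensive.

Import Order.TTheory GRing.Theory Num.Theory.
Local Open Scope ring_scope.

(* R[i], declared as a numFieldType so that it carries the topology that the
   analysis library puts on every numFieldType. *)
Definition Cplx (R : realType) : numFieldType := R[i].

(* The ring K[[z]] of formal power series. *)
Record fps (K : fieldType) := Fps { fps_coef :> nat -> K }.

Section FormalPowerSeries.
Variable K : fieldType.
Implicit Types a b c : fps K.

HB.instance Definition _ := gen_eqMixin (fps K).
HB.instance Definition _ := gen_choiceMixin (fps K).

Lemma fpsP a b : (forall k, a k = b k) -> a = b.
Proof. by case: a b => [a] [b] /= ab; congr Fps; apply/funext. Qed.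

Definition fpsC (x : K) : fps K := Fps (fun k => if k is 0%N then x else 0).
Definition fpsX : fps K := Fps (fun k => (k == 1)%:R).
Definition fps_add a b : fps K := Fps (fun k => a k + b k).
Definition fps_opp a : fps K := Fps (fun k => - a k).
Definition fps_mul a b : fps K :=
  Fps (fun k => \sum_(j < k.+1) a j * b (k - j)%N).

Let trunc (m : nat) a : {poly K} := \poly_(i < m.+1) a i.

Let truncM m a b k : (k <= m)%N -> fps_mul a b k = (trunc m a * trunc m b)`_k.
Proof.
move=> km; rewrite coefM; apply: eq_bigr => j _.
by rewrite !coef_poly !ltnS (leq_trans (leq_subr _ _) km)
  (leq_trans (leq_ord j) km).
Qed.

Let fps_addA : associative fps_add.
Proof. by move=> a b c; apply: fpsP => k /=; rewrite addrA. Qed.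

Let fps_addC : commutative fps_add.
Proof. by move=> a b; apply: fpsP => k /=; rewrite addrC. Qed.

Let fps_add0 : left_id (fpsC 0) fps_add.
Proof. by move=> a; apply: fpsP => -[|k] /=; rewrite add0r. Qed.

Let fps_addN : left_inverse (fpsC 0) fps_opp fps_add.
Proof. by move=> a; apply: fpsP => -[|k] /=; rewrite addNr. Qed.

HB.instance Definition _ :=
  GRing.isZmodule.Build (fps K) fps_addA fps_addC fps_add0 fps_addN.

Let fps_mulC : commutative fps_mul.
Proof.
by move=> a b; apply: fpsP => k; rewrite !(@truncM k) // mulrC.
Qed.

Let fps_mulA : associative fps_mul.
Proof.
move=> a b c; apply: fpsP => k.
have -> : fps_mul a (fps_mul b c) k =
    (trunc k a * (trunc k b * trunc k c))`_k.
  rewrite coefM /=; apply: eq_bigr => j _.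
  by rewrite coef_poly ltnS leq_ord -truncM ?leq_subr.
rewrite mulrA coefM /=; apply: eq_bigr => j _.
by rewrite coef_poly ltnS leq_subr -truncM // leq_ord.
Qed.

Let fps_mul1 : left_id (fpsC 1) fps_mul.
Proof.
move=> a; apply: fpsP => k /=.
by rewrite big_ord_recl /= mul1r subn0 big1 ?addr0 // => j _; rewrite mul0r.
Qed.

Let fps_mulDl : left_distributive fps_mul fps_add.
Proof.
move=> a b c; apply: fpsP => k /=; rewrite -big_split /=.
by apply: eq_bigr => j _; rewrite mulrDl.
Qed.

Let fps_1_neq0 : fpsC 1 != 0.
Proof.
by apply/eqP => /(congr1 (fun a => fps_coef a 0)) /= /eqP; rewrite oner_eq0.
Qed.

HB.instance Definition _ := GRing.Zmodule_isComNzRing.Build (fps K)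
  fps_mulA fps_mulC fps_mul1 fps_mulDl fps_1_neq0.

Let fps_unit : pred (fps K) := fun a => `[< exists b, b * a = 1 >].
Let fps_inv a : fps K :=
  if pselect (exists b, b * a = 1) is left h then projT1 (cid h) else a.

Let fps_mulV : {in fps_unit, left_inverse 1 fps_inv *%R}.
Proof.
move=> a /asboolP ua; rewrite /fps_inv.
by case: pselect => // h; case: (cid h).
Qed.

Let fps_unitP a b : b * a = 1 -> fps_unit a.
Proof. by move=> ba; apply/asboolP; exists b. Qed.

Let fps_inv_out : {in [predC fps_unit], fps_inv =1 id}.
Proof.
move=> a; rewrite inE /= => /asboolP nua; rewrite /fps_inv.
by case: pselect.
Qed.

HB.instance Definition _ := GRing.ComNzRing_hasMulInverse.Build (fps K)
  fps_mulV fps_unitP fps_inv_out.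

Let fps_lead a : a != 0 -> exists2 m, a m != 0 & forall j, (j < m)%N -> a j = 0.
Proof.
move=> a0; have ex : exists m, a m != 0.
  apply: contrapT => /forallNP na; case/eqP: a0.
  by apply: fpsP => k; have /negP/negPn/eqP -> := na k; case: k.
exists (ex_minn ex); case: ex_minnP => m // am min_m j jm.
by apply/eqP; apply: contraLR jm => aj; rewrite -leqNgt min_m.
Qed.

Let fps_idomain a b : a * b = 0 -> (a == 0) || (b == 0).
Proof.
move=> ab0; apply/norP => -[/fps_lead [m am am0] /fps_lead [k bk bk0]].
have /eqP : (a * b) (m + k)%N = 0 by rewrite ab0; case: (m + k)%N.
have mk : (m < (m + k).+1)%N by rewrite ltnS leq_addr.
rewrite [_ (m + k)%N]/= (bigD1 (Ordinal mk)) //= addKn big1 ?addr0.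
  by rewrite mulf_eq0 (negPf am) (negPf bk).
move=> j; rewrite -val_eqE /= neq_ltn => /orP[/am0 -> | mj].
  by rewrite mul0r.
by rewrite bk0 ?mulr0 // ltn_subLR ?ltn_add2r // -ltnS.
Qed.

HB.instance Definition _ :=
  GRing.ComUnitRing_isIntegral.Build (fps K) fps_idomain.

End FormalPowerSeries.

(* The field K((z)) of formal Laurent series is the field of fractions of
   K[[z]]. *)
Definition flaurent (K : fieldType) : fieldType := {fraction fps K}.

Definition flaurentC (K : fieldType) (x : K) : flaurent K := tofrac (fpsC x).

(* The series z^-m * sum_(k >= 0) a_k z^k, and its termwise derivative
   z^-(m+1) * sum_(k >= 0) (k - m) a_k z^k *)
Definition laurent (K : fieldType) (m : nat) (a : nat -> K) : flaurent K :=
  tofrac (Fps a) / tofrac (fpsX K) ^+ m.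
Definition laurent_deriv (K : fieldType) (m : nat) (a : nat -> K) :
    flaurent K :=
  laurent m.+1 (fun k => (k%:R - m%:R) * a k).

(* Rational functions of n variables, as quotients of polynomials which need
   not be coprime *)
Record ratfun (n : nat) (K : fieldType) := Ratfun {
  rnum : mpoly n K;
  rden : mpoly n K;
  rden_neq0 : rden != 0
}.

Section RationalFunctions.
Variables (n : nat) (K : fieldType).
Implicit Types (f : ratfun n K) (w : 'cV[K]_n).

Definition rdefined f w : bool := meval (fun j => w j 0) (rden f) != 0.

(* Meaningful at the points where f is defined *)
Definition reval f w : K :=
  meval (fun j => w j 0) (rnum f) / meval (fun j => w j 0) (rden f).

Lemma sqr_rden_neq0 f : rden f ^+ 2 != 0.
Proof. by rewrite expf_neq0 // rden_neq0. Qed.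

Definition rderiv (j : 'I_n) f : ratfun n K :=
  @Ratfun n K
    (mderiv j (rnum f) * rden f - rnum f * mderiv j (rden f))
    (rden f ^+ 2) (sqr_rden_neq0 f).

(* Weighted scaling (a^s_1 w_1, ..., a^s_n w_n) *)
Definition wscale (s : 'I_n -> nat) (a : K) w : 'cV[K]_n :=
  \col_i (a ^+ s i * w i 0).

(* The identity of rational functions is tested at the points where both of
   its sides are defined. *)
Definition quasi_homogeneous (f : 'I_n -> ratfun n K) (s : 'I_n -> nat) :=
  forall (a : K), a != 0 -> forall i w,
    rdefined (f i) w -> rdefined (f i) (wscale s a w) ->
    reval (f i) (wscale s a w) = a ^+ (s i).+1 * reval (f i) w.

(* Substituting w_i = z^-s_i * sum_k c_i^(k) z^k in dw_i/dz = f_i(w) yields an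
   identity of formal Laurent series; c k is the column vector c^(k). *)
Definition formal_solution (f : 'I_n -> ratfun n K) (s : 'I_n -> nat)
    (c : nat -> 'cV[K]_n) :=
  let w i := laurent (s i) (fun k => c k i 0) in
  forall i,
    mmap (@flaurentC K) w (rden (f i)) != 0 /\
    laurent_deriv (s i) (fun k => c k i 0) =
      mmap (@flaurentC K) w (rnum (f i)) / mmap (@flaurentC K) w (rden (f i)).

(* The Jacobian matrix of the map with components s_i w_i + f_i(w) *)
Definition kovalevskaya_mx (f : 'I_n -> ratfun n K) (s : 'I_n -> nat) w :
    'M[K]_n :=
  \matrix_(i, j) (reval (rderiv j (f i)) w + (i == j)%:R * (s i)%:R).

(* The value of a polynomial T in the k * n variables c_j^(l), with l < k *)
Definition eval_coefs (k : nat) (T : mpoly (k * n) K) (c : nat -> 'cV[K]_n) :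
    K :=
  meval (fun x => mxvec (\matrix_(l < k, j < n) c l j 0) 0 x) T.

End RationalFunctions.

(* Main.v *)
Require Import Defs.
From HB Require Import structures.
From mathcomp Require Import all_boot all_order all_algebra.
From mathcomp Require Import complex.
From mathcomp Require Import boolp classical_sets reals topology normedtype sequences.
From mathcomp Require Import ring lra.
From mathcomp Require Import -(notations) mpoly.

Set Implicit Arguments.
Unset Strict Implicit.
Unset Printing Implicit Defensive.

Import Order.TTheory GRing.Theory Num.Theory numFieldNormedType.Exports.
Local Open Scope ring_scope.
Local Open Scope classical_set_scope.

(** Put u_i = sum_k c_i^(k) z^k, so that w_i = z^-s_i u_i.  Since K is infinite,
    quasi-homogeneity is an identity between polynomials
    ([quasi_homogeneous_poly]); evaluated in the field of Laurent series, at the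
    scaling parameter 1/z, it gives f_i(w) = z^-(s_i + 1) f_i(u).  The system
    thereby becomes an equation between power series ([formal_solution_fps]),

      (z u_i' - s_i u_i) Q_i(u) = P_i(u)   where f_i = P_i / Q_i.

    Its constant term gives the equations for c^(0).  Expand it to first order
    about c^(0), writing u = c^(0) + y: the part linear in y is Q_i(c^(0)) times
    the i-th component of (z d/dz - L) y, and what remains is a polynomial
    without constant and linear terms in y and z y'.  Hence for k >= 1

      Q_i(c^(0)) ((L - k) c^(k))_i = - [z^k] (nonlinear part)

    ([linear_recurrence]), where the right-hand side involves only c^(0), ...,
    c^(k-1), because a product of two series without constant terms does not see
    the last coefficients of its factors.

    This one observation is used twice, so the structural induction over
    polynomials is done once, for abstract classes of series of order one and
    two ([order_classes], [ord2_nonlinear_part]).  With the class of series whose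
    coefficients are polynomials in the preceding c^(l), it gives the form of the
    linear systems.  With the class of series bounded by a power of

      D_N(r) = sum_(k < N) k |c^(k)| r^k

    it bounds the nonlinear part up to z^N by a multiple of D_N^2.  As
    |(k - L)^-1| = O(1/k) for k large, D_(N+1) <= H r + 2 B D_N^2 when D_N <= 1;
    for small r an induction keeps all the D_N at most 2 H r
    ([weighted_norm_bounded]), so the series converges absolutely.  The weight k
    accounts for the derivative in the nonlinear part and is paid for by the
    factor 1/k from the inverse of k - L. *)

(** * Multivariate polynomials *)

Local Notation xvar i := (mpolyX _ (mnm1 i)).

Lemma mpoly_ring_ind (n : nat) (K : comNzRingType) (P : mpoly n K -> Prop) :
  (forall x, P (mpolyC n x)) -> (forall i : 'I_n, P (xvar i)) ->
  (forall p q, P p -> P q -> P (p + q)) ->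
  (forall p q, P p -> P q -> P (p * q)) -> forall p, P p.
Proof.
move=> PC PX PD PM; elim/mpolyind => [|x m p _ _ Pp]; first exact: (PC 0).
apply: (PD) => //; rewrite -mul_mpolyC; apply: (PM) => //.
rewrite mpolyXE_id; elim/big_ind: _ => [|p1 p2|i _]; first exact: (PC 1).
  exact: PM.
by elim: (m i) => [|k Pk]; rewrite ?expr0 ?exprS; [exact: (PC 1)|exact: PM].
Qed.

Lemma mmapM (n : nat) (K A : comNzRingType) (phi : {rmorphism K -> A})
  (u : 'I_n -> A) : {morph mmap phi u : p q / p * q}.
Proof. exact: rmorphM. Qed.

Lemma poly_eq0_of_horner (K : numFieldType) (p : {poly K}) :
  (forall x, p.[x] = 0) -> p = 0.
Proof.
move=> p0; pose rs := [seq i%:R | i <- iota 0 (size p)] : seq K.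
apply: (@roots_geq_poly_eq0 _ _ rs).
- by apply/allP => _ /mapP[i _ ->]; rewrite rootE p0.
- by rewrite map_inj_uniq ?iota_uniq // => i j /eqP; rewrite eqr_nat => /eqP.
- by rewrite size_map size_iota.
Qed.

(** By induction on the number of variables: [p] is viewed as a polynomial in its
    first variable, which vanishes at infinitely many points, with coefficients
    in the others. *)
Lemma meval_inj0 (n : nat) (K : numFieldType) (p : mpoly n K) :
  (forall v, meval v p = 0) -> p = 0.
Proof.
elim: n p => [|n IHn] p p0.
  have -> : p = mpolyC 0 (meval (fun=> 0) p).
    elim/mpoly_ring_ind: p {p0} => [x|[]//|p q ep eq|p q ep eq].
    - by rewrite mevalC.
    - by rewrite mevalD mpolyCD -ep -eq.
    - by rewrite mevalM mpolyCM -ep -eq.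
  by rewrite p0 mpolyC0.
pose h (i : 'I_n.+1) : {poly mpoly n K} :=
  if unlift ord0 i is Some j then (xvar j)%:P else 'X.
pose u : {rmorphism mpoly n.+1 K -> {poly mpoly n K}} :=
  mmap (polyC \o @mpolyC n K) h.
have uC x : u (mpolyC _ x) = (mpolyC n x)%:P by rewrite /u /= mmapC.
have uX i : u (xvar i) = h i by rewrite /u /= mmapX mmap1U.
move: u uC uX => u uC uX.
pose back : {rmorphism mpoly n K -> mpoly n.+1 K} :=
  mmap (@mpolyC n.+1 K) (fun j => xvar (lift ord0 j)).
have bC x : back (mpolyC _ x) = mpolyC _ x by rewrite /back /= mmapC.
have bX i : back (xvar i) = xvar (lift ord0 i).
  by rewrite /back /= mmapX mmap1U.
move: back bC bX => back bC bX.
have uK : (map_poly back (u p)).[xvar ord0] = p.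
  elim/mpoly_ring_ind: (p) => [x|i|q r eq er|q r eq er].
  - by rewrite uC map_polyC hornerC /= bC.
  - rewrite uX /h; case: unliftP => [j ->|->].
      by rewrite map_polyC hornerC /= bX.
    by rewrite map_polyX hornerX.
  - by rewrite (rmorphD u) rmorphD hornerD eq er.
  - by rewrite (rmorphM u) rmorphM hornerM eq er.
have ev v x : (map_poly (meval v) (u p)).[x] =
    meval (fun i => if unlift ord0 i is Some j then v j else x) p.
  elim/mpoly_ring_ind: (p) => [y|i|q r eq er|q r eq er].
  - by rewrite uC map_polyC hornerC /= !mevalC.
  - rewrite uX /h mevalXU; case: unliftP => [j _|_].
      by rewrite map_polyC hornerC /= mevalXU.
    by rewrite map_polyX hornerX.
  - by rewrite (rmorphD u) rmorphD hornerD mevalD eq er.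
  - by rewrite (rmorphM u) rmorphM hornerM mevalM eq er.
(* As [back] recovers p from u p, it is enough that u p vanishes. *)
suff u0 : u p = 0 by rewrite -uK u0 rmorph0 horner0.
apply/polyP => k; rewrite coef0; apply: IHn => v.
have : map_poly (meval v) (u p) = 0; last first.
  by move=> /polyP/(_ k); rewrite coef_map coef0.
by apply: poly_eq0_of_horner => x; rewrite ev p0.
Qed.

(** * Quasi-homogeneity as a polynomial identity *)

Section QuasiHomogeneous.
Variables (n : nat) (K : numFieldType) (s : 'I_n -> nat).

(** Keeping the scaling parameter t as a variable makes it possible to give it
    the value 1/z later.  The definition is locked because unification would
    otherwise unfold it to compare it with constant polynomials. *)
Definition wscale_poly : {rmorphism mpoly n K -> {poly mpoly n K}} :=
  locked (mmap (polyC \o @mpolyC n K) (fun j => (xvar j)%:P * 'X^(s j))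
    : {rmorphism mpoly n K -> {poly mpoly n K}}).

Lemma wscale_polyC x : wscale_poly (mpolyC n x) = (mpolyC n x)%:P.
Proof. by rewrite /wscale_poly -lock /= mmapC. Qed.

Lemma wscale_polyX j : wscale_poly (xvar j) = (xvar j)%:P * 'X^(s j).
Proof. by rewrite /wscale_poly -lock /= mmapX mmap1U. Qed.

Lemma wscale_polyD : {morph wscale_poly : p q / p + q}.
Proof. exact: rmorphD. Qed.

Lemma wscale_polyM : {morph wscale_poly : p q / p * q}.
Proof. exact: rmorphM. Qed.

Lemma horner_wscale_poly (A : comNzRingType) (phi : {rmorphism K -> A})
    (u : 'I_n -> A) (t : A) p :
  (map_poly (mmap phi u) (wscale_poly p)).[t] =
  mmap phi (fun j => t ^+ s j * u j) p.
Proof.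
elim/mpoly_ring_ind: p => [x|j|p q ep eq|p q ep eq].
- by rewrite wscale_polyC map_polyC hornerC /= !mmapC.
- rewrite wscale_polyX rmorphM /= hornerM map_polyC hornerC map_polyXn hornerXn.
  by rewrite /= !mmapX !mmap1U mulrC.
- by rewrite wscale_polyD mmapD -ep -eq -hornerD; congr _.[t]; exact: rmorphD.
- rewrite wscale_polyM mmapM -ep -eq -hornerM; congr _.[t].
  exact: rmorphM.
Qed.

(** The functional equation holds at every point where the denominators do not
    vanish; after multiplication by these denominators it holds everywhere, and
    K is infinite. *)
Lemma quasi_homogeneous_poly (f : ratfun n K) (d : nat) :
  (forall a : K, a != 0 -> forall w,
    rdefined f w -> rdefined f (wscale s a w) ->
    reval f (wscale s a w) = a ^+ d * reval f w) ->
  wscale_poly (rnum f) * (rden f)%:P =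
  'X^d * (rnum f)%:P * wscale_poly (rden f).
Proof.
move=> qh; apply/eqP; rewrite -subr_eq0; apply/eqP.
set G := _ - _; apply/polyP => k; rewrite coef0.
suff : G`_k * rden f = 0.
  by move/eqP; rewrite mulf_eq0 (negPf (rden_neq0 f)) orbF => /eqP.
apply: meval_inj0 => v; rewrite mevalM.
have [->|Qv] := eqVneq (meval v (rden f)) 0; first by rewrite mulr0.
pose w : 'cV[K]_n := \col_j v j.
have ev p (a : K) : (map_poly (meval v) (wscale_poly p)).[a] =
    meval (fun j => wscale s a w j 0) p.
  rewrite [LHS](horner_wscale_poly idfun); apply: meval_eq => j.
  by rewrite !mxE.
have wv p : meval (fun j => w j 0) p = meval v p.
  by apply: meval_eq => j; rewrite mxE.
have GQ0 : map_poly (meval v) G * 'X *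
    map_poly (meval v) (wscale_poly (rden f)) = 0.
  apply: poly_eq0_of_horner => a; rewrite !hornerM hornerX ev.
  have [->|a0] := eqVneq a 0; first by rewrite mulr0 mul0r.
  set q := meval _ (rden f); have [->|Qa] := eqVneq q 0; first by rewrite mulr0.
  have Qw : rdefined f w by rewrite /rdefined wv.
  have := qh a a0 w Qw Qa; rewrite /reval !wv -/q => qha.
  suff -> : (map_poly (meval v) G).[a] = 0 by rewrite !mul0r.
  rewrite rmorphB !rmorphM /= hornerD hornerN !hornerM !map_polyC !hornerC.
  rewrite map_polyXn hornerXn !ev /= -/q.
  apply/eqP; rewrite subr_eq0; apply/eqP.
  by rewrite -[LHS](divfK Qa) [_ * _ / q]mulrAC qha mulrA divfK.
have Q1 : map_poly (meval v) (wscale_poly (rden f)) != 0.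
  apply/eqP => /(congr1 (fun p => p.[1])); rewrite horner0 ev.
  rewrite (meval_eq (v2 := v)) => [/eqP|j]; first exact/negP.
  by rewrite !mxE expr1n mul1r.
move/eqP: GQ0; rewrite !mulf_eq0 (negPf Q1) polyX_eq0 !orbF => /eqP.
by move=> /polyP/(_ k); rewrite coef_map coef0 => ->; rewrite mul0r.
Qed.

(** With A the field of Laurent series and t = 1/z, this extends the functional
    equation from the constants to power series u_j. *)
Lemma quasi_homogeneous_eval (A : comNzRingType) (phi : {rmorphism K -> A})
    (u : 'I_n -> A) (t : A) (p q : mpoly n K) (d : nat) :
  wscale_poly p * q%:P = 'X^d * p%:P * wscale_poly q ->
  mmap phi (fun j => t ^+ s j * u j) p * mmap phi u q =
  t ^+ d * mmap phi u p * mmap phi (fun j => t ^+ s j * u j) q.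
Proof.
move=> /(congr1 (fun g => (map_poly (mmap phi u) g).[t])).
rewrite !rmorphM /= !hornerM !horner_wscale_poly !map_polyC !hornerC /=.
by rewrite map_polyXn hornerXn.
Qed.

End QuasiHomogeneous.

(** * Substitution of formal power series *)

Section SeriesSubstitution.
Variables (n : nat) (K : fieldType).

Lemma fpsC_zmod_morphism : zmod_morphism (@fpsC K).
Proof. by move=> x y; apply: fpsP => -[|k] /=; rewrite ?oppr0 ?addr0. Qed.

Lemma fpsCM x (a : fps K) k : (fpsC x * a) k = x * a k.
Proof.
rewrite /= big_ord_recl /= subn0 big1 ?addr0 // => j _.
by rewrite mul0r.
Qed.

Lemma fpsC_monoid_morphism : monoid_morphism (@fpsC K).
Proof.
by split=> // x y; apply: fpsP => k; rewrite fpsCM; case: k => [|k] /=;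
  rewrite ?mulr0.
Qed.

HB.instance Definition _ :=
  GRing.isZmodMorphism.Build K (fps K) (@fpsC K) fpsC_zmod_morphism.
HB.instance Definition _ :=
  GRing.isMonoidMorphism.Build K (fps K) (@fpsC K) fpsC_monoid_morphism.
HB.instance Definition _ := GRing.RMorphism.copy (@flaurentC K)
  (@tofrac (fps K) \o @fpsC K).

Lemma fps_coefD (a b : fps K) k : (a + b) k = a k + b k.
Proof. by []. Qed.

Lemma fps_coefN (a : fps K) k : (- a) k = - a k.
Proof. by []. Qed.

Lemma fps_coef_sum (I : Type) (r : seq I) (F : I -> fps K) k :
  (\sum_(i <- r) F i) k = \sum_(i <- r) F i k.
Proof.
elim/big_rec2: _ => [|i x y _ <-]; [by case: k|by rewrite fps_coefD].
Qed.

Lemma fps_coef0M (a b : fps K) : (a * b) 0%N = a 0%N * b 0%N.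
Proof. by rewrite /= big_ord_recl big_ord0 addr0. Qed.

Lemma mmap_fps_coef0 (u : 'I_n -> fps K) p :
  (mmap (@fpsC K) u p) 0%N = meval (fun j => u j 0%N) p.
Proof.
elim/mpoly_ring_ind: p => [x|j|p q ep eq|p q ep eq].
- by rewrite mmapC mevalC.
- by rewrite mmapX mmap1U mevalXU.
- by rewrite mmapD mevalD -ep -eq.
- by rewrite mmapM mevalM fps_coef0M ep eq.
Qed.

Lemma mmap_flaurent (u : 'I_n -> fps K) p :
  mmap (@flaurentC K) (fun j => tofrac (u j)) p = tofrac (mmap (@fpsC K) u p).
Proof.
elim/mpoly_ring_ind: p => [x|j|p q ep eq|p q ep eq].
- by rewrite !mmapC.
- by rewrite !mmapX !mmap1U.
- by rewrite !mmapD rmorphD ep eq.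
- by rewrite !mmapM rmorphM ep eq.
Qed.

Lemma fpsX_neq0 : fpsX K != 0.
Proof.
apply/eqP => /(congr1 (fun a => fps_coef a 1)) /= /eqP.
by rewrite oner_eq0.
Qed.

End SeriesSubstitution.

(** Multiplying the system by suitable powers of z turns it into an equation
    between power series, in which the s_i only enter the derivative: by
    quasi-homogeneity, f_i(z^-s_1 u_1, ..., z^-s_n u_n) is
    z^-(s_i + 1) f_i(u_1, ..., u_n). *)
Lemma formal_solution_fps (n : nat) (K : numFieldType) (f : 'I_n -> ratfun n K)
    (s : 'I_n -> nat) (c : nat -> 'cV[K]_n) :
  quasi_homogeneous f s -> formal_solution f s c ->
  (forall i, rdefined (f i) (c 0%N)) ->
  let u j := Fps (fun k => c k j 0) in
  forall i, Fps (fun k => (k%:R - (s i)%:R) * c k i 0) *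
    mmap (@fpsC K) u (rden (f i)) = mmap (@fpsC K) u (rnum (f i)).
Proof.
move=> qh sol cdef u i; have [] := sol i.
set w := fun j => laurent _ _; move=> Qw; rewrite /laurent_deriv /laurent.
have Xn0 : tofrac (fpsX K) != 0 by rewrite tofrac_eq0 fpsX_neq0.
set D := Fps _; have [t tE] : exists t, t = (tofrac (fpsX K))^-1 by eexists.
have wE : w =1 (fun j => t ^+ s j * tofrac (u j)).
  by move=> j; rewrite /w /laurent mulrC -exprVn tE.
have wP p : mmap (@flaurentC K) w p =
    mmap (@flaurentC K) (fun j => t ^+ s j * tofrac (u j)) p.
  by congr (mmap _ _ p); apply: funext.
have := quasi_homogeneous_poly (fun a a0 => qh a a0 i).
move=> /(quasi_homogeneous_eval (@flaurentC K) (fun j => tofrac (u j)) t).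
rewrite -!wP !mmap_flaurent => qhu eqD.
have Qu : tofrac (mmap (@fpsC K) u (rden (f i))) != 0.
  rewrite tofrac_eq0; apply/eqP => /(congr1 (fun a => fps_coef a 0)).
  by rewrite mmap_fps_coef0 => /eqP; apply/negP/(cdef i).
apply/eqP; rewrite -tofrac_eq; apply/eqP; rewrite rmorphM.
have tn0 : t ^+ (s i).+1 != 0.
  by apply: expf_neq0; rewrite tE; exact: invr_neq0.
apply: (mulfI tn0); apply: (mulIf Qw); rewrite -qhu [t ^+ _ * _]mulrA.
rewrite mulrAC; congr (_ * _).
by rewrite [t ^+ _ * _]mulrC tE exprVn eqD; exact: divfK.
Qed.

(** * Remainders of order two *)

Section OrderClasses.
Variables (n : nat) (K : fieldType) (X : Type).
Implicit Types (l : X -> K) (a b : X -> fps K) (p q : mpoly n K).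

(** [O1] and [O2] are meant to contain the families of series of order at least
    one, respectively two, in some small data, and [S] the admissible scalars.
    Both predicates concern families indexed by [X], so that a class may also
    express the dependence on the data. *)
Record order_classes (S : (X -> K) -> Prop) (O1 O2 : (X -> fps K) -> Prop) :
    Prop := OrderClasses {
  scalC : forall x, S (fun=> x);
  scalD : forall l1 l2, S l1 -> S l2 -> S (fun c => l1 c + l2 c);
  scalM : forall l1 l2, S l1 -> S l2 -> S (fun c => l1 c * l2 c);
  ord1D : forall a b, O1 a -> O1 b -> O1 (fun c => a c + b c);
  ord1Z : forall l a, S l -> O1 a -> O1 (fun c => fpsC (l c) * a c);
  ord2D : forall a b, O2 a -> O2 b -> O2 (fun c => a c + b c);
  ord2Z : forall l a, S l -> O2 a -> O2 (fun c => fpsC (l c) * a c);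
  ord2_0 : O2 (fun=> 0);
  ord21 : forall a, O2 a -> O1 a;
  ord1M : forall a b, O1 a -> O1 b -> O2 (fun c => a c * b c)
}.

Variables (x : X -> 'I_n -> K) (y : X -> 'I_n -> fps K).

Definition taylor1 p c : fps K :=
  \sum_j fpsC (meval (x c) (mderiv j p)) * y c j.

Definition taylor_rem p c : fps K :=
  mmap (@fpsC K) (fun j => fpsC (x c j) + y c j) p -
    fpsC (meval (x c) p) - taylor1 p c.

Lemma taylor_expansion p c :
  mmap (@fpsC K) (fun j => fpsC (x c j) + y c j) p =
  fpsC (meval (x c) p) + taylor1 p c + taylor_rem p c.
Proof. by rewrite /taylor_rem; ring. Qed.

Lemma taylor_remC z c : taylor_rem (mpolyC n z) c = 0.
Proof.
rewrite /taylor_rem mmapC mevalC subrr sub0r /taylor1 big1 ?oppr0 // => j _.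
by rewrite mderivC meval0 rmorph0 mul0r.
Qed.

Lemma taylor_remX i c : taylor_rem (xvar i) c = 0.
Proof.
rewrite /taylor_rem mmapX mmap1U mevalXU [_ - fpsC _]addrC addKr /taylor1.
rewrite (bigD1 i) //= big1 => [|j ji].
  rewrite mderivX mnm1E eqxx scale1r mevalX big1 => [|k _].
    by rewrite rmorph1 mul1r addr0 subrr.
  by rewrite mnmBE subnn expr0.
by rewrite mderivX mnm1E eq_sym (negPf ji) scale0r meval0 rmorph0 mul0r.
Qed.

Lemma taylor_remD p q c :
  taylor_rem (p + q) c = taylor_rem p c + taylor_rem q c.
Proof.
have t1D : taylor1 (p + q) c = taylor1 p c + taylor1 q c.
  rewrite /taylor1 -big_split; apply: eq_bigr => j _.
  by rewrite mderivD mevalD rmorphD mulrDl.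
by rewrite /taylor_rem t1D mmapD mevalD rmorphD /=; ring.
Qed.

Lemma taylor_remM p q c : taylor_rem (p * q) c =
  fpsC (meval (x c) p) * taylor_rem q c +
  fpsC (meval (x c) q) * taylor_rem p c +
  (taylor1 p c + taylor_rem p c) * (taylor1 q c + taylor_rem q c).
Proof.
have t1M : taylor1 (p * q) c = fpsC (meval (x c) p) * taylor1 q c +
    fpsC (meval (x c) q) * taylor1 p c.
  rewrite /taylor1 !mulr_sumr -big_split; apply: eq_bigr => j _ /=.
  by rewrite mderivM mevalD !mevalM rmorphD !rmorphM /=; ring.
rewrite {1}/taylor_rem mmapM !taylor_expansion t1M mevalM rmorphM /=.
by ring.
Qed.

Variables (S : (X -> K) -> Prop) (O1 O2 : (X -> fps K) -> Prop).
Hypothesis cl : order_classes S O1 O2.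
Hypothesis Sx : forall j, S (fun c => x c j).
Hypothesis O1y : forall j, O1 (fun c => y c j).

Lemma scal_meval p : S (fun c => meval (x c) p).
Proof.
elim/mpoly_ring_ind: p => [z|j|p q Sp Sq|p q Sp Sq].
- by under eq_fun do rewrite mevalC; exact: (scalC cl).
- by under eq_fun do rewrite mevalXU; exact: Sx.
- by under eq_fun do rewrite mevalD; exact: (scalD cl).
- by under eq_fun do rewrite mevalM; exact: (scalM cl).
Qed.

Lemma ord1_taylor1 p : O1 (fun c => taylor1 p c).
Proof.
rewrite /taylor1; elim: (index_enum _) => [|j r IHr].
  by under eq_fun do rewrite big_nil; apply/(ord21 cl)/(ord2_0 cl).
under eq_fun do rewrite big_cons.
by apply: (ord1D cl) IHr; apply: (ord1Z cl) => //; exact: scal_meval.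
Qed.

Lemma ord2_taylor_rem p : O2 (fun c => taylor_rem p c).
Proof.
elim/mpoly_ring_ind: p => [z|j|p q Sp Sq|p q Sp Sq].
- by under eq_fun do rewrite taylor_remC; exact: (ord2_0 cl).
- by under eq_fun do rewrite taylor_remX; exact: (ord2_0 cl).
- by under eq_fun do rewrite taylor_remD; exact: (ord2D cl).
- have O1_ r : O2 (fun c => taylor_rem r c) ->
      O1 (fun c => taylor1 r c + taylor_rem r c).
    by move=> /(ord21 cl); apply: (ord1D cl); exact: ord1_taylor1.
  under eq_fun do rewrite taylor_remM.
  apply: (ord2D cl); last by apply: (ord1M cl); exact: O1_.
  by apply: (ord2D cl); apply: (ord2Z cl) => //; exact: scal_meval.
Qed.

End OrderClasses.

(** * The recurrence for the coefficients *)

Section Recurrence.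
Variables (n : nat) (K : numFieldType).
Variables (f : 'I_n -> ratfun n K) (s : 'I_n -> nat).
Implicit Types c : nat -> 'cV[K]_n.

Definition center c (j : 'I_n) : K := c 0%N j 0.
Definition tail c (j : 'I_n) : fps K :=
  Fps (fun k => if k is 0%N then 0 else c k j 0).
Definition tail_deriv c (i : 'I_n) : fps K :=
  Fps (fun k => if k is 0%N then 0 else (k%:R - (s i)%:R) * c k i 0).

(** All the terms of the system of order at least two in the tails of the series
    and their derivatives. *)
Definition nonlinear_part (i : 'I_n) c : fps K :=
  let rem p := taylor_rem center tail p c in
  rem (rnum (f i)) + fpsC ((s i)%:R * center c i) * rem (rden (f i)) +
  fpsC (- 1) * ((taylor1 center tail (rden (f i)) c + rem (rden (f i))) *
    tail_deriv c i).

Lemma ord2_nonlinear_part (S : _ -> Prop) (O1 O2 : _ -> Prop) i :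
  order_classes S O1 O2 ->
  (forall j, S (fun c => center c j)) -> (forall j, O1 (fun c => tail c j)) ->
  O1 (fun c => tail_deriv c i) -> O2 (nonlinear_part i).
Proof.
move=> cl Sx O1y O1v; have rem2 p := ord2_taylor_rem cl Sx O1y p.
apply: (ord2D cl); last apply: (ord2Z cl); last apply: (ord1M cl) => //.
- apply: (ord2D cl) => //; apply: (ord2Z cl) => //.
  by apply: (scalM cl) => //; exact: (scalC cl).
- exact: (scalC cl).
- apply: (ord1D cl); last exact: (ord21 cl).
  exact: (ord1_taylor1 cl Sx O1y).
Qed.

Variable c : nat -> 'cV[K]_n.
Hypothesis cdef : forall i, rdefined (f i) (c 0%N).
Hypothesis sol : forall i,
  Fps (fun k => (k%:R - (s i)%:R) * c k i 0) *
    mmap (@fpsC K) (fun j => Fps (fun k => c k j 0)) (rden (f i)) =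
  mmap (@fpsC K) (fun j => Fps (fun k => c k j 0)) (rnum (f i)).

Lemma leading_coef_eq i : (s i)%:R * c 0%N i 0 + reval (f i) (c 0%N) = 0.
Proof.
have := congr1 (fun a => fps_coef a 0) (sol i).
rewrite fps_coef0M !mmap_fps_coef0 /= sub0r /reval => <-.
by rewrite mulfK ?mulNr ?subrr //; exact: (cdef i).
Qed.

Lemma linear_recurrence k i : (0 < k)%N ->
  meval (center c) (rden (f i)) *
    ((kovalevskaya_mx f s (c 0%N) - k%:R%:M) *m c k) i 0 =
  - nonlinear_part i c k.
Proof.
move=> k0; set q := meval _ _; have q0 : q != 0 := cdef i.
have uE j : Fps (fun k => c k j 0) = fpsC (center c j) + tail c j.
  by apply: fpsP => -[|m]; rewrite /= ?addr0 ?add0r.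
have dE : Fps (fun k => (k%:R - (s i)%:R) * c k i 0) =
    fpsC (- ((s i)%:R * center c i)) + tail_deriv c i.
  by apply: fpsP => -[|m]; rewrite /= ?addr0 ?sub0r ?mulNr ?add0r.
have pq : meval (center c) (rnum (f i)) = - ((s i)%:R * center c i * q).
  have /eqP := leading_coef_eq i; rewrite addr_eq0 => /eqP ->.
  by rewrite mulNr opprK divfK.
have := sol i; rewrite (funext uE) dE !taylor_expansion pq -/q.
set lq := taylor1 _ _ (rden _) c; set lp := taylor1 _ _ (rnum _) c.
set rq := taylor_rem _ _ (rden _) c; set rp := taylor_rem _ _ (rnum _) c.
have lE p : taylor1 center tail p c k =
    \sum_j meval (center c) (mderiv j p) * c k j 0.
  rewrite fps_coef_sum; apply: eq_bigr => j _; rewrite fpsCM.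
  by case: k k0.
move=> eqn.
have {eqn} : fpsC q * tail_deriv c i - fpsC ((s i)%:R * center c i) * lq - lp =
    nonlinear_part i c.
  rewrite /nonlinear_part -/lq -/rq -/rp; move: eqn.
  rewrite !rmorphN !rmorphM rmorph1 /= => eqn.
  apply/eqP; rewrite -subr_eq0; apply/eqP.
  move/eqP: eqn; rewrite -subr_eq0 => /eqP <-.
  by ring.
move=> <-; rewrite !fps_coefD !fps_coefN !fpsCM !lE.
have -> : tail_deriv c i k = (k%:R - (s i)%:R) * c k i 0 by case: k k0 lE.
rewrite mulmxBl mul_scalar_mx !mxE.
have -> : \sum_j kovalevskaya_mx f s (c 0%N) i j * c k j 0 =
   \sum_j (meval (center c) (mderiv j (rnum (f i))) +
      (s i)%:R * center c i * meval (center c) (mderiv j (rden (f i)))) / q *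
      c k j 0 + (s i)%:R * c k i 0.
  transitivity (\sum_j ((meval (center c) (mderiv j (rnum (f i))) +
      (s i)%:R * center c i * meval (center c) (mderiv j (rden (f i)))) / q *
      c k j 0 + (i == j)%:R * ((s i)%:R * c k i 0))).
    apply: eq_bigr => j _; rewrite mxE mulrDl; congr (_ * _ + _).
      rewrite /reval /rderiv /= mevalB !mevalM.
      rewrite -![meval (fun j => c 0%N j 0)]/(meval (center c)) -/q pq.
      by field.
    by case: eqP => [->|_]; rewrite ?mul1r // !mul0r.
  rewrite big_split /=; congr (_ + _).
  rewrite (bigD1 i) //= eqxx mul1r big1 ?addr0 // => j ji.
  by rewrite eq_sym (negPf ji) mul0r.
have -> : \sum_j (meval (center c) (mderiv j (rnum (f i))) +
      (s i)%:R * center c i * meval (center c) (mderiv j (rden (f i)))) / q *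
      c k j 0 =
    (\sum_j meval (center c) (mderiv j (rnum (f i))) * c k j 0 +
     (s i)%:R * center c i *
       \sum_j meval (center c) (mderiv j (rden (f i))) * c k j 0) / q.
  rewrite mulr_sumr -big_split mulr_suml; apply: eq_bigr => j _ /=.
  by ring.
by field.
Qed.

End Recurrence.

(** * Polynomial dependence on the preceding coefficients *)

Section PolynomialCoefficients.
Variables (n : nat) (K : fieldType) (k : nat).
Implicit Types (F G : (nat -> 'cV[K]_n) -> K).

Definition poly_coefs F :=
  exists T : mpoly (k * n) K, forall c, F c = eval_coefs T c.

Lemma poly_coefsC x : poly_coefs (fun=> x).
Proof. by exists (mpolyC _ x) => c; rewrite /eval_coefs mevalC. Qed.

Lemma poly_coefsD F G :
  poly_coefs F -> poly_coefs G -> poly_coefs (fun c => F c + G c).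
Proof.
move=> [S FS] [T GT]; exists (S + T) => c.
by rewrite FS GT /eval_coefs mevalD.
Qed.

Lemma poly_coefsM F G :
  poly_coefs F -> poly_coefs G -> poly_coefs (fun c => F c * G c).
Proof.
move=> [S FS] [T GT]; exists (S * T) => c.
by rewrite FS GT /eval_coefs mevalM.
Qed.

Lemma poly_coefs_sum (I : Type) (r : seq I) (F : I -> _) :
  (forall i, poly_coefs (F i)) -> poly_coefs (fun c => \sum_(i <- r) F i c).
Proof.
move=> SF; elim: r => [|i r IHr].
  by under eq_fun do rewrite big_nil; exact: poly_coefsC.
by under eq_fun do rewrite big_cons; exact: poly_coefsD.
Qed.

Lemma poly_coefs_var l j : (l < k)%N -> poly_coefs (fun c => c l j 0).
Proof.
move=> lk; exists (xvar (mxvec_index (Ordinal lk) j)) => c.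
by rewrite /eval_coefs mevalXU mxvecE mxE.
Qed.

Definition poly_series m (a : (nat -> 'cV[K]_n) -> fps K) :=
  (forall c, a c 0%N = 0) /\
  forall j, (j < m)%N -> poly_coefs (fun c => a c j).

(** In the coefficient of z^k in a product of two series without constant terms
    only the coefficients of z, ..., z^(k-1) of the factors occur. *)
Lemma poly_order_classes :
  order_classes poly_coefs (poly_series k) (poly_series k.+1).
Proof.
have serD m a b : poly_series m a -> poly_series m b ->
    poly_series m (fun c => a c + b c).
  move=> [a0 Ha] [b0 Hb]; split=> [c|j jm]; first by rewrite /= a0 b0 addr0.
  by apply: poly_coefsD; [exact: Ha|exact: Hb].
have serZ m l a : poly_coefs l -> poly_series m a ->
    poly_series m (fun c => fpsC (l c) * a c).
  move=> Hl [a0 Ha]; split=> [c|j jm]; first by rewrite fpsCM a0 mulr0.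
  by under eq_fun do rewrite fpsCM; apply: poly_coefsM => //; exact: Ha.
split; [exact: poly_coefsC|exact: poly_coefsD|exact: poly_coefsM
  |exact: serD|exact: serZ|exact: serD|exact: serZ| | |].
- by split=> // -[|j] _; exact: poly_coefsC.
- by move=> a [a0 Ha]; split=> // j jk; apply: Ha; exact: leqW.
- move=> a b [a0 Ha] [b0 Hb]; split=> [c|m mk].
    by rewrite fps_coef0M a0 mul0r.
  apply: poly_coefs_sum => -[j /= jm].
  have [->|j0] := posnP j.
    by under eq_fun do rewrite a0 mul0r; exact: poly_coefsC.
  have [->|mj] := eqVneq j m.
    by under eq_fun do rewrite subnn b0 mulr0; exact: poly_coefsC.
  have jm' : (j < m)%N by rewrite ltn_neqAle mj -ltnS.
  apply: poly_coefsM; [apply: Ha|apply: Hb].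
    exact: leq_trans jm' _.
  by rewrite -ltnS (leq_trans _ mk) // ltnS ltn_subrL j0 (leq_trans _ jm').
Qed.

End PolynomialCoefficients.

Lemma poly_nonlinear_part (n : nat) (K : numFieldType)
    (f : 'I_n -> ratfun n K) (s : 'I_n -> nat) k i : (0 < k)%N ->
  exists T : mpoly (k * n) K, forall c,
    - nonlinear_part f s i c k = eval_coefs T c.
Proof.
move=> k0.
have tailP (g : nat -> K) j : poly_series k k (fun c : nat -> 'cV[K]_n =>
    Fps (fun l => if l is 0%N then 0 else g l * c l j 0)).
  split=> // -[|l] lk /=; first exact: poly_coefsC.
  by apply: poly_coefsM; [exact: poly_coefsC|exact: poly_coefs_var].
have [|j||_ /(_ k (leqnn _)) [T HT]] :=
    ord2_nonlinear_part (s := s) (i := i) f (@poly_order_classes n K k).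
- by move=> j; exact: poly_coefs_var.
- have := tailP (fun=> 1) j; congr (poly_series _ _ _).
  apply: funext => c; apply: fpsP => -[|l] //=.
  by rewrite mul1r.
- exact: tailP (fun l => l%:R - (s i)%:R) i.
- by exists (- T) => c; rewrite HT /eval_coefs mevalN.
Qed.

(** * Norm estimates *)

Section Modulus.
Variable R : realType.
Implicit Types x y : Cplx R.

Definition cabs x : R := complex.Re `|x|.

Lemma normr_cabs x : `|x| = ((cabs x)%:C)%C.
Proof. by rewrite /cabs RRe_real // normr_real. Qed.

Lemma cabs_ge0 x : 0 <= cabs x.
Proof. by rewrite -lecR -[(cabs x)%:C%C]normr_cabs; exact: normr_ge0. Qed.

Lemma cabsM x y : cabs (x * y) = cabs x * cabs y.
Proof.
by apply: complexI; rewrite [RHS]rmorphM -!normr_cabs; exact: normrM.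
Qed.

Lemma cabs0 : cabs 0 = 0.
Proof. by rewrite /cabs normr0. Qed.

Lemma ler_cabsD x y : cabs (x + y) <= cabs x + cabs y.
Proof.
by rewrite -lecR [X in _ <= X]rmorphD -!normr_cabs; exact: ler_normD.
Qed.

Lemma ler_cabs_sum (I : Type) (r : seq I) (F : I -> Cplx R) :
  cabs (\sum_(i <- r) F i) <= \sum_(i <- r) cabs (F i).
Proof.
elim: r => [|i r IHr]; first by rewrite !big_nil cabs0.
rewrite !big_cons; apply: le_trans (ler_cabsD _ _) _.
by rewrite lerD2l.
Qed.

Lemma cabs_nat k : cabs k%:R = k%:R.
Proof. by rewrite /cabs normr_nat -(rmorph_nat (real_complex R)). Qed.

Lemma cabsX x k : cabs (x ^+ k) = cabs x ^+ k.
Proof.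
elim: k => [|k IHk]; first by rewrite !expr0 -[1]/(1%:R) cabs_nat.
by rewrite !exprS cabsM IHk.
Qed.

Lemma cabsN x : cabs (- x) = cabs x.
Proof. by rewrite /cabs normrN. Qed.

Lemma cabs_gt0 x : x != 0 -> 0 < cabs x.
Proof. by rewrite -normr_gt0 normr_cabs -ltcR. Qed.

End Modulus.

Section PartialNorms.
Variable R : realType.
Implicit Types (a b : fps (Cplx R)) (r : R).

Definition fps_norm a N r : R := \sum_(k < N) cabs (a k) * r ^+ k.

Lemma fps_norm_ge0 a N r : 0 <= r -> 0 <= fps_norm a N r.
Proof.
by move=> r0; apply: sumr_ge0 => k _; rewrite mulr_ge0 ?cabs_ge0 ?exprn_ge0.
Qed.

Lemma fps_norm_recr a N r :
  fps_norm a N.+1 r = fps_norm a N r + cabs (a N) * r ^+ N.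
Proof. by rewrite /fps_norm big_ord_recr. Qed.

Lemma ler_fps_norm a N M r : 0 <= r -> (N <= M)%N ->
  fps_norm a N r <= fps_norm a M r.
Proof.
move=> r0 /subnK <-; elim: (M - N)%N => [|m IHm]; first by rewrite add0n.
rewrite addSn fps_norm_recr (le_trans IHm) // lerDl.
by rewrite mulr_ge0 ?cabs_ge0 ?exprn_ge0.
Qed.

Lemma ler_fps_normD a b N r : 0 <= r ->
  fps_norm (a + b) N r <= fps_norm a N r + fps_norm b N r.
Proof.
move=> r0; rewrite /fps_norm -big_split /=; apply: ler_sum => k _.
by rewrite -mulrDl ler_wpM2r ?exprn_ge0 ?ler_cabsD.
Qed.

Lemma fps_normZ x a N r :
  fps_norm (fpsC x * a) N r = cabs x * fps_norm a N r.
Proof.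
rewrite /fps_norm mulr_sumr; apply: eq_bigr => k _.
by rewrite fpsCM cabsM mulrA.
Qed.

Lemma ler_fps_norm_conv a b N r : 0 <= r ->
  fps_norm (a * b) N r <=
  \sum_(j < N) cabs (a j) * r ^+ j * fps_norm b (N - j) r.
Proof.
move=> r0; elim: N => [|N IHN]; first by rewrite /fps_norm !big_ord0.
have -> : \sum_(j < N.+1) cabs (a j) * r ^+ j * fps_norm b (N.+1 - j) r =
    \sum_(j < N) cabs (a j) * r ^+ j * fps_norm b (N - j) r +
    \sum_(j < N.+1) cabs (a j) * cabs (b (N - j)%N) * r ^+ N.
  rewrite [in RHS]big_ord_recr big_ord_recr /= addrA -big_split /=.
  congr (_ + _); last first.
    by rewrite subSn // subnn /fps_norm big_ord1 expr0; ring.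
  apply: eq_bigr => j _; have jN := ltnW (ltn_ord j).
  have rN : r ^+ N = r ^+ j * r ^+ (N - j) by rewrite -exprD subnKC.
  by rewrite subSn // fps_norm_recr rN; ring.
rewrite fps_norm_recr lerD //.
rewrite -mulr_suml ler_wpM2r ?exprn_ge0 //.
apply: le_trans (ler_cabs_sum _ _) _.
by apply: ler_sum => j _; rewrite cabsM.
Qed.

(** Since both constant terms vanish, the product gains one index over its
    factors. *)
Lemma ler_fps_normM a b N r : 0 <= r -> a 0%N = 0 -> b 0%N = 0 ->
  fps_norm (a * b) N.+1 r <= fps_norm a N r * fps_norm b N r.
Proof.
move=> r0 a0 b0; apply: le_trans (ler_fps_norm_conv _ _ _ r0) _.
rewrite big_ord_recr /= subSn // subnn.
have -> : fps_norm b 1 r = 0 by rewrite /fps_norm big_ord1 b0 cabs0 mul0r.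
rewrite mulr0 addr0 mulr_suml; apply: ler_sum => -[[|j] /= jN] _.
  by rewrite a0 cabs0 !mul0r.
rewrite ler_wpM2l ?mulr_ge0 ?cabs_ge0 ?exprn_ge0 // ler_fps_norm //.
by rewrite subSS leq_subr.
Qed.

End PartialNorms.

Section MajorantClasses.
Variables (R : realType) (n : nat) (c : nat -> 'cV[Cplx R]_n).
Implicit Types (N : nat) (r : R).

Definition coef_size k : R := \sum_i cabs (c k i 0).

(** Weighting the coefficients by their index controls the series and their
    derivatives at once. *)
Definition weighted_norm N r : R := \sum_(k < N) k%:R * coef_size k * r ^+ k.

Lemma coef_size_ge0 k : 0 <= coef_size k.
Proof. by apply: sumr_ge0 => i _; exact: cabs_ge0. Qed.

Lemma ler_coef_size k i : cabs (c k i 0) <= coef_size k.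
Proof.
by rewrite /coef_size (bigD1 i) //= lerDl sumr_ge0 // => j _; exact: cabs_ge0.
Qed.

Lemma weighted_norm_ge0 N r : 0 <= r -> 0 <= weighted_norm N r.
Proof.
move=> r0; apply: sumr_ge0 => k _.
by rewrite !mulr_ge0 ?ler0n ?coef_size_ge0 ?exprn_ge0.
Qed.

(** The case [d = 0] bounds a series linearly, the case [d = 1] quadratically by
    the weighted norm of one coefficient less. *)
Definition bounded d (a : (nat -> 'cV[Cplx R]_n) -> fps (Cplx R)) :=
  a c 0%N = 0 /\ exists2 B, 0 <= B & forall N r, 0 <= r ->
    weighted_norm N r <= 1 ->
    fps_norm (a c) (d + N) r <= B * weighted_norm N r ^+ d.+1.

Lemma bounded_order_classes :
  order_classes (fun=> True) (bounded 0) (bounded 1).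
Proof.
have bddD d a b : bounded d a -> bounded d b -> bounded d (fun c => a c + b c).
  move=> [a0 [A A0 HA]] [b0 [B B0 HB]]; split; first by rewrite /= a0 b0 addr0.
  exists (A + B) => [|N r r0 D1]; first exact: addr_ge0.
  rewrite mulrDl (le_trans (ler_fps_normD _ _ _ r0)) // lerD //; [exact: HA|].
  exact: HB.
have bddZ d l a : bounded d a -> bounded d (fun c => fpsC (l c) * a c).
  move=> [a0 [A A0 HA]]; split; first by rewrite fpsCM a0 mulr0.
  exists (cabs (l c) * A) => [|N r r0 D1]; first by rewrite mulr_ge0 ?cabs_ge0.
  by rewrite fps_normZ -mulrA ler_wpM2l ?cabs_ge0 ?HA.
split=> //; [exact: bddD| |exact: bddD| | | |].
- by move=> l a _; exact: bddZ.
- by move=> l a _; exact: bddZ.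
- split=> //; exists 0 => // N r r0 D1; rewrite mul0r /fps_norm big1 // => k _.
  have -> : (0 : fps (Cplx R)) k = 0 by case: (nat_of_ord k).
  by rewrite cabs0 mul0r.
- move=> a [a0 [A A0 HA]]; split=> //; exists A => // N r r0 D1.
  apply: le_trans (ler_fps_norm _ r0 (leqnSn N)) _.
  apply: le_trans (HA _ _ r0 D1) _; rewrite ler_wpM2l // expr2 expr1.
  by rewrite ler_piMr ?weighted_norm_ge0.
- move=> a b [a0 [A A0 HA]] [b0 [B B0 HB]]; split.
    by rewrite fps_coef0M a0 mul0r.
  exists (A * B) => [|N r r0 D1]; first exact: mulr_ge0.
  rewrite (le_trans (ler_fps_normM _ r0 a0 b0)) // expr2 mulrACA.
  by rewrite ler_pM ?fps_norm_ge0 ?HA ?HB.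
Qed.

Lemma bounded_dominated (a : _ -> fps (Cplx R)) B : a c 0%N = 0 -> 0 <= B ->
  (forall k, cabs (a c k) <= B * (k%:R * coef_size k)) -> bounded 0 a.
Proof.
move=> a0 B0 aB; split=> //; exists B => // N r r0 _.
rewrite expr1 /weighted_norm mulr_sumr; apply: ler_sum => k _.
by rewrite mulrA ler_wpM2r ?exprn_ge0.
Qed.

Lemma bounded_tail j : bounded 0 (fun c => tail c j).
Proof.
apply: (bounded_dominated (B := 1)) => // -[|k] /=.
  by rewrite cabs0 mul0r mulr0.
rewrite mul1r (le_trans (ler_coef_size _ _)) // ler_peMl ?coef_size_ge0 //.
by rewrite ler1n.
Qed.

Lemma bounded_tail_deriv (s : 'I_n -> nat) i :
  bounded 0 (fun c => tail_deriv s c i).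
Proof.
apply: (bounded_dominated (B := 1 + (s i)%:R)) => [//||-[|k] /=].
- by rewrite addr_ge0 ?ler0n.
- by rewrite cabs0 mul0r mulr0.
rewrite cabsM mulrA ler_pM ?cabs_ge0 ?ler_coef_size //.
rewrite (le_trans (ler_cabsD _ _)) // cabsN !cabs_nat mulrDl mul1r lerD2l.
by rewrite ler_peMr ?ler0n ?ler1n.
Qed.

End MajorantClasses.

(** * Convergence *)

Section Convergence.
Variables (R : realType) (n : nat) (c : nat -> 'cV[Cplx R]_n).
Variables (L : 'M[Cplx R]_n) (q : 'I_n -> Cplx R).
Variable E : 'I_n -> (nat -> 'cV[Cplx R]_n) -> fps (Cplx R).
Hypothesis q_neq0 : forall i, q i != 0.
Hypothesis E_bounded : forall i, bounded c 1 (E i).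
Hypothesis recurrence : forall k i, (0 < k)%N ->
  q i * ((L - k%:R%:M) *m c k) i 0 = - E i c k.

Let nonlin k : R := \sum_i cabs (E i c k) / cabs (q i).

Let nonlin_ge0 k : 0 <= nonlin k.
Proof. by apply: sumr_ge0 => i _; rewrite divr_ge0 ?cabs_ge0. Qed.

(** For large k the matrix L - kI is dominated by its diagonal kI, so that no
    resonance occurs; the finitely many remaining indices only contribute to
    the constant of [weighted_norm_bounded]. *)
Lemma coef_size_bound : exists k0, forall k, (k0 <= k)%N ->
  k%:R * coef_size c k <= 2 * nonlin k.
Proof.
pose l : R := \sum_i \sum_j cabs (L i j).
have l0 : 0 <= l by do 2![apply: sumr_ge0 => ? _]; exact: cabs_ge0.
(* From k >= 2 l on, half of k |c^(k)| absorbs |L c^(k)|. *)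
exists (Num.bound (2 * l)) => k kl.
have lk : 2 * l <= k%:R.
  apply: le_trans (_ : (Num.bound (2 * l))%:R <= _); last by rewrite ler_nat.
  by apply/ltW/archi_boundP; rewrite mulr_ge0.
have [->|k0] := posnP k; first by rewrite mul0r mulr_ge0.
suff : k%:R * coef_size c k <= l * coef_size c k + nonlin k.
  by have := coef_size_ge0 c k; nra.
rewrite {1}/coef_size mulr_sumr /nonlin /l mulr_suml -big_split /=.
apply: ler_sum => i _.
have eqc : k%:R * c k i 0 = \sum_j L i j * c k j 0 + E i c k / q i.
  have /(canRL (mulKf (q_neq0 i))) := recurrence i k0.
  rewrite mulmxBl mul_scalar_mx !mxE mulrN mulrC => /eqP.
  by rewrite subr_eq => /eqP ->; ring.
rewrite -[k%:R](cabs_nat R) -cabsM eqc (le_trans (ler_cabsD _ _)) // lerD //.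
  apply: le_trans (ler_cabs_sum _ _) _; rewrite mulr_suml.
  apply: ler_sum => j _; rewrite cabsM ler_wpM2l ?cabs_ge0 //.
  exact: ler_coef_size.
rewrite ler_pdivlMr ?cabs_gt0 // -cabsM divfK //.
Qed.

Lemma nonlin_bound : exists2 B, 0 <= B & forall N r, 0 <= r ->
  weighted_norm c N r <= 1 ->
  \sum_(k < N.+1) nonlin k * r ^+ k <= B * weighted_norm c N r ^+ 2.
Proof.
have /choice[B HB] : forall i, exists B, 0 <= B /\ forall N r, 0 <= r ->
    weighted_norm c N r <= 1 ->
    fps_norm (E i c) N.+1 r <= B * weighted_norm c N r ^+ 2.
  by move=> i; have [_ [B B0 HB]] := E_bounded i; exists B.
exists (\sum_i B i / cabs (q i)) => [|N r r0 D1].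
  by apply: sumr_ge0 => i _; rewrite divr_ge0 ?cabs_ge0 //; case: (HB i).
have -> : \sum_(k < N.+1) nonlin k * r ^+ k =
    \sum_i fps_norm (E i c) N.+1 r / cabs (q i).
  under eq_bigr do rewrite mulr_suml.
  rewrite exchange_big; apply: eq_bigr => i _; rewrite mulr_suml.
  by apply: eq_bigr => k _; rewrite mulrAC.
rewrite mulr_suml; apply: ler_sum => i _; rewrite [leRHS]mulrAC.
rewrite ler_wpM2r ?invr_ge0 ?cabs_ge0 //.
by have [_ ->] := HB i.
Qed.

(** If D_N denotes the weighted norm of the first N coefficients, then
    D_(N+1) <= H r + 2 B D_N^2 as long as D_N <= 1, and the interval
    [0, 2 H r] is stable under this iteration when r is small. *)
Lemma weighted_norm_bounded :
  exists2 r, 0 < r & forall N, weighted_norm c N r <= 1.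
Proof.
have [k0 Hk0] := coef_size_bound; have [B B0 HB] := nonlin_bound.
pose g k : R := if (k < k0)%N then k%:R * coef_size c k else 0.
have kc0 k : 0 <= k%:R * coef_size c k by rewrite mulr_ge0 ?coef_size_ge0.
have g0 k : 0 <= g k by rewrite /g; case: ifP.
pose H := \sum_(k < k0) g k.
have H0 : 0 <= H by apply: sumr_ge0 => k _.
have gH N : \sum_(k < N) g k <= H.
  apply: (@le_trans _ _ (\sum_(k < k0 + N) g k)).
    by rewrite addnC big_split_ord /= lerDl sumr_ge0.
  rewrite big_split_ord /= -[leRHS]addr0 lerD2l big1 // => k _.
  by rewrite /g ltnNge leq_addr.
(* This value of r makes both 2 H r and 8 B H r at most 1. *)
pose r := (1 + 2 * H + 8 * (B * H))^-1.
have BH0 : 0 <= B * H by exact: mulr_ge0.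
have r0 : 0 < r by rewrite invr_gt0; lra.
have rE : r * (1 + 2 * H + 8 * (B * H)) = 1.
  by rewrite mulVf // gt_eqF //; lra.
have r1 : r <= 1 by nra.
have Hr : 2 * (H * r) <= 1 by nra.
have BHr : 8 * (B * H * r) <= 1 by nra.
have step N : weighted_norm c N r <= 1 ->
    weighted_norm c N.+1 r <= H * r + 2 * (B * weighted_norm c N r ^+ 2).
  move=> D1; apply: le_trans (_ : \sum_(k < N.+1) (g k * r) +
      2 * \sum_(k < N.+1) nonlin k * r ^+ k <= _).
    rewrite mulr_sumr -big_split /=; apply: ler_sum => k _.
    have rk0 : 0 <= r ^+ k by rewrite exprn_ge0 // ltW.
    have e0 := mulr_ge0 (nonlin_ge0 k) rk0.
    have [kk0|kk0] := ltnP k k0; last first.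
      have := ler_wpM2r rk0 (Hk0 _ kk0).
      by have := mulr_ge0 (g0 k) (ltW r0); lra.
    rewrite /g kk0; suff : k%:R * coef_size c k * r ^+ k <=
      k%:R * coef_size c k * r by lra.
    case: (nat_of_ord k) (kc0 k) => [|m] km; first by rewrite !mul0r.
    by rewrite ler_wpM2l // exprS ler_piMr ?exprn_ile1 // ltW.
  rewrite lerD ?ler_wpM2l ?HB //; last exact: ltW.
  by rewrite -mulr_suml ler_wpM2r // ltW.
exists r => // N; apply: (le_trans _ Hr).
elim: N => [|N IHN]; first by rewrite /weighted_norm big_ord0 !mulr_ge0 // ltW.
apply: le_trans (step N (le_trans IHN Hr)) _.
have D0 : 0 <= weighted_norm c N r by apply: weighted_norm_ge0; exact: ltW.
set D := weighted_norm c N r in IHN D0 *.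
have D2 : D ^+ 2 <= 4 * (H * r) ^+ 2.
  have -> : 4 * (H * r) ^+ 2 = (2 * (H * r)) ^+ 2 by ring.
  by rewrite ler_pXn2r // nnegrE !mulr_ge0 // ltW.
have := ler_wpM2l B0 D2.
have : H * r * (8 * (B * H * r)) <= H * r.
  by rewrite ler_piMr // mulr_ge0 // ltW.
by rewrite !expr2; lra.
Qed.

End Convergence.

Lemma cabs_le_Re_Im (R : realType) (x : Cplx R) :
  cabs x <= `|complex.Re x| + `|complex.Im x|.
Proof.
rewrite /cabs normc_def /= -[leRHS]ger0_norm ?addr_ge0 // -sqrtr_sqr.
rewrite ler_wsqrtr // sqrrD !real_normK ?num_real //.
by rewrite lerD2r lerDl mulrn_wge0 ?mulr_ge0.
Qed.

(** Completeness of the complex numbers, from that of the reals applied to the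
    real and imaginary parts. *)
Lemma cvgn_cplx_series (R : realType) (a : nat -> Cplx R) (M : R) :
  (forall N, \sum_(k < N) cabs (a k) <= M) -> cvgn (series a).
Proof.
move=> aM.
have cvg_part (p : Cplx R -> R) : (forall x, `|p x| <= cabs x) ->
    cvgn (series (p \o a)).
  move=> pa; apply: normed_cvg; apply: nondecreasing_is_cvgn.
    by apply: nondecreasing_series => k _ _; exact: normr_ge0.
  exists M => _ [N _ <-]; rewrite /normed_series_of seriesEord.
  by apply: le_trans (aM N); apply: ler_sum => k _; exact: pa.
have Re_le (x : Cplx R) : `|complex.Re x| <= cabs x.
  by rewrite -lecR -normr_cabs; exact: normc_ge_Re.
have Im_le (x : Cplx R) : `|complex.Im x| <= cabs x.
  (* Up to sign, Im x is the real part of i x. *)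
  have := Re_le (x * 'i%C); rewrite ReiNIm normrN cabsM.
  suff -> : cabs ('i%C : Cplx R) = 1 by rewrite mulr1.
  by rewrite /cabs normc_def /= expr0n expr1n add0r sqrtr1.
have /cvg_ex[lr /cvgrPdist_lt Hr] := cvg_part _ Re_le.
have /cvg_ex[li /cvgrPdist_lt Hi] := cvg_part _ Im_le.
apply/cvg_ex; exists (Complex lr li); apply/cvgrPdist_lt => e e0.
have eE : e = ((complex.Re e)%:C)%C by rewrite RRe_real // gtr0_real.
have e2 : 0 < complex.Re e / 2 by rewrite divr_gt0 // -ltcR -eE.
near=> N.
rewrite eE normr_cabs ltcR (le_lt_trans (cabs_le_Re_Im _)) //.
have ReB (x y : Cplx R) : complex.Re (x - y) = complex.Re x - complex.Re y.
  by case: x; case: y.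
have ImB (x y : Cplx R) : complex.Im (x - y) = complex.Im x - complex.Im y.
  by case: x; case: y.
have ReS : complex.Re (series a N) = series (@complex.Re R \o a) N.
  by apply: big_morph => // -[? ?] [? ?].
have ImS : complex.Im (series a N) = series (@complex.Im R \o a) N.
  by apply: big_morph => // -[? ?] [? ?].
rewrite ReB ImB ReS ImS [ltRHS]splitr ltrD //=.
  by near: N; exact: Hr.
by near: N; exact: Hi.
Unshelve. all: by end_near. Qed.

Theorem mainTheorem1 (R : realType) (n : nat)
    (f : 'I_n -> ratfun n (Cplx R)) (s : 'I_n -> nat)
    (s_gt0 : forall i, (0 < s i)%N)
    (qh : quasi_homogeneous f s) :
  exists (T : forall k : nat, 'I_n -> mpoly (k * n) (Cplx R))
         (N : nat -> 'I_n -> nat),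
  forall c : nat -> 'cV[Cplx R]_n,
    formal_solution f s c ->
    c 0%N != 0 ->
    (forall i, rdefined (f i) (c 0%N)) ->
    [/\ forall i, (s i)%:R * c 0%N i 0 + reval (f i) (c 0%N) = 0,
        forall k, (0 < k)%N ->
          (kovalevskaya_mx f s (c 0%N) - k%:R%:M) *m c k =
          \col_i (eval_coefs (T k i) c /
                  meval (fun j => c 0%N j 0) (rden (f i)) ^+ N k i)
      & exists2 r : R, 0 < r &
          forall z : Cplx R, 0 < `|z| < (r%:C)%C ->
          forall i, cvgn (series (fun k : nat =>
            c k i 0 * z ^ (k%:Z - (s i)%:Z)))].
Proof.
have exT k : exists T : 'I_n -> mpoly (k * n) (Cplx R), (0 < k)%N ->
    forall i c, - nonlinear_part f s i c k = eval_coefs (T i) c.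
  have [->|k0] := posnP k; first by exists (fun=> 0).
  have /choice[T HT] := fun i => poly_nonlinear_part f s i k0.
  by exists T.
(* The recurrence contains a single factor Q_i(c^(0)): all exponents are 1. *)
exists (fun k => projT1 (cid (exT k))), (fun _ _ => 1%N) => c sol _ cdef.
have solP := formal_solution_fps qh sol cdef.
have rec := linear_recurrence cdef solP.
split.
- exact: leading_coef_eq.
- move=> k k0; apply/colP => i; rewrite mxE expr1.
  rewrite -(projT2 (cid (exT k)) k0) -rec // mulrC mulKf //; exact: (cdef i).
have Ebd i : bounded c 1 (nonlinear_part f s i).
  apply: ord2_nonlinear_part (bounded_order_classes c) _ _ _ => //.
  - exact: bounded_tail.
  - exact: bounded_tail_deriv.
have [r r0 rbd] := weighted_norm_bounded cdef Ebd (fun k i => rec k i).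
exists r => // z /andP[z0 zr] i.
have {}z0 : z != 0 by rewrite -normr_gt0.
have {}zr : cabs z <= r by rewrite ltW // -ltcR -normr_cabs.
pose C := cabs (z ^- s i).
apply: (@cvgn_cplx_series _ _ ((cabs (c 0%N i 0) + 1) * C)) => N.
apply: (@le_trans _ _ (\sum_(k < N) cabs (c k i 0) * r ^+ k * C)).
  apply: ler_sum => k _; rewrite expfzDr // -exprnN.
  rewrite mulrA !cabsM cabsX ler_wpM2r ?cabs_ge0 // ler_wpM2l ?cabs_ge0 //.
  by rewrite lerXn2r ?nnegrE ?cabs_ge0 // ltW.
rewrite -mulr_suml ler_wpM2r ?cabs_ge0 //.
case: N => [|N]; first by rewrite big_ord0 addr_ge0 ?cabs_ge0.
rewrite big_ord_recl expr0 mulr1 lerD2l (le_trans _ (rbd N.+1)) //.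
rewrite /weighted_norm big_ord_recl !mul0r add0r; apply: ler_sum => k _.
rewrite ler_wpM2r ?exprn_ge0 ?(ltW r0) // (le_trans (ler_coef_size _ _ i)) //.
by rewrite ler_peMl ?coef_size_ge0 // ler1n.
Qed.
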